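(* Let $\lambda\in(0,1]$. For each auxiliary cost $m\ge 0$, let $\pi_{\mathsf D}$ be the threshold policy with thresholds $D_a(m)$, $a=1,2,\dots$, given in the context, i.e. in state $(a,d)$ it schedules the terminal if $d\ge D_a(m)$ and idles otherwise; let $\Pi_m=\{(a,d): a\ge 1,\ d\ge 0,\ d<D_a(m)\}$ be the set of states in which the prescribed (optimal) action is to idle. Then $\pi_{\mathsf D}$ is indexable, that is: (i) for all $m_1,m_2\ge 0$ with $m_1<m_2$ one has $\Pi_{m_1}\subseteq\Pi_{m_2}$; (ii) $\Pi_0=\emptyset$; (iii) as $m\to\infty$, $\Pi_m$ becomes the entire state space, i.e. every state $(a,d)$ belongs to $\Pi_m$ for all sufficiently large $m$.
   Context: Decoupled model: a single terminal in slotted time has state $(a,d)$ with integers $a\ge1$ (age of the packet at the terminal) and $d\ge0$ (age-of-information at the destination minus $a$). Packets arrive as i.i.d. Bernoulli($\lambda$). If idle ($u=0$), $(a,d)\to(a+1,d)$ with probability $1-\lambda$ and $(a,d)\to(1,d+a)$ with probability $\lambda$. If scheduled ($u=1$), $(a,d)\to(a+1,0)$ with probability $1-\lambda$ and $(a,d)\to(1,a)$ with probability $\lambda$. The per-slot cost is $a+d(1-u)+mu$, and the long-run average cost is minimized. Thresholds of $\pi_{\mathsf D}$: for $m\ge0$ let $\beta=\beta(m)$ be the unique nonnegative solution (positive if $m>0$) of $\frac12\beta^2+\left(\frac1\lambda-\frac12\right)\beta-m=0$. Set $D_1(m)=\beta$, and for the remaining $a$, $$D_a(m)=\begin{cases}(1-\lambda+a\lambda)\beta-\lambda\frac{(a-1)a}{2},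 & \text{if } 1\le a<\beta,\\ \lambda m, & \text{if } a\ge\beta.\end{cases}$$ The thresholds are allowed to be real numbers. *)

(* Defs.v *)
From HB Require Import structures.
From mathcomp Require Import all_boot all_order all_algebra.
From mathcomp Require Import all_classical all_reals all_analysis.

Set Implicit Arguments.
Unset Strict Implicit.
Unset Printing Implicit Defensive.

Import Order.TTheory GRing.Theory Num.Theory.
Import numFieldNormedType.Exports.

Local Open Scope classical_set_scope.
Local Open Scope ring_scope.

(* A state is a pair (a, d): a is the age of the packet at the terminal, and
   d is the age of information at the destination minus a. *)
Definition state := (nat * nat)%type.

Definition state_space : set state := [set s | (1 <= s.1)%N].

Inductive action := Idle | Schedule.

Definition policy := state -> action.

Definition idle_set (pi : policy) : set state :=
  [set s | state_space s /\ pi s = Idle].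

Definition threshold_policy (R : realType) (D : nat -> R) : policy :=
  fun s => if D s.1 <= s.2%:R then Schedule else Idle.

Lemma idle_set_threshold (R : realType) (D : nat -> R) :
  idle_set (threshold_policy D) =
  [set s | (1 <= s.1)%N /\ s.2%:R < D s.1].
Proof.
apply/seteqP; split=> -[a d]; rewrite /idle_set /threshold_policy /= ltNge.
  by case: ifP => _ [].
by move=> [a1 /negbTE ->].
Qed.

(* Indexability of a family of policies indexed by the auxiliary cost m; only
   the values at m >= 0 matter. *)
Definition indexable (R : realType) (pi : R -> policy) : Prop :=
  [/\ forall m1 m2 : R, 0 <= m1 -> 0 <= m2 -> m1 < m2 ->
        idle_set (pi m1) `<=` idle_set (pi m2),
      idle_set (pi 0) = set0
    & forall s : state, state_space s ->
        \forall m \near +oo, idle_set (pi m) s].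

Definition is_beta (R : realType) (lambda m b : R) : Prop :=
  0 <= b /\ 2^-1 * b ^+ 2 + (lambda^-1 - 2^-1) * b - m = 0.

(* The nonnegative root, picked by choice (0 if there is none); for
   0 < lambda <= 1 and 0 <= m it exists and is unique. *)
Definition beta (R : realType) (lambda m : R) : R :=
  xget 0 [set b | is_beta lambda m b].

(* The case a = 1 takes precedence: when beta <= 1 the threshold at a = 1 is
   beta, not lambda * m. The value at a = 0, outside the state space, is
   irrelevant. *)
Definition threshold (R : realType) (lambda m : R) (a : nat) : R :=
  let b := beta lambda m in
  if a == 1%N then b
  else if a%:R < b then
    (1 - lambda + a%:R * lambda) * b - lambda * ((a%:R - 1) * a%:R / 2)
  else lambda * m.

Definition pi_D (R : realType) (lambda m : R) : policy :=
  threshold_policy (threshold lambda m).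

(* Main.v *)
Require Import Defs.
From mathcomp Require Import all_boot all_order all_algebra.
From mathcomp Require Import all_classical all_reals all_analysis.
From mathcomp Require Import ring lra.

Import Order.TTheory GRing.Theory Num.Theory.

Local Open Scope ring_scope.

(** The map [b |-> b^2/2 + (1/lambda - 1/2) b] is an increasing bijection of the
    nonnegative reals, so [beta] increases with [m]. On either side of
    [beta = a] the threshold is nondecreasing in [beta], and the two expressions
    agree at [beta = a], where [lambda m = lambda a^2/2 + (1 - lambda/2) a];
    hence each threshold is nondecreasing in [m]. Divergence follows since for
    [beta > a] the threshold is at least [beta - lambda (a - 1) a / 2]. *)

Section Thresholds.
Variables (R : realType) (lambda : R).
Hypotheses (lambda_gt0 : 0 < lambda) (lambda_le1 : lambda <= 1).

Lemma betaP (m : R) : 0 <= m -> is_beta lambda m (beta lambda m).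
Proof.
move=> m0; rewrite /beta; case: xgetP => [b _ //|].
set c := lambda^-1 - 2^-1; have c0 : 0 <= c.
  by have := lambda_le1; rewrite -invf_ge1 // /c; lra.
have s0 : 0 <= c ^+ 2 + 2 * m by nra.
(* The larger root from the quadratic formula; it is nonnegative because [c] and [m] are. *)
move/(_ (Num.sqrt (c ^+ 2 + 2 * m) - c)); case; split.
  by rewrite subr_ge0 -[leLHS](ger0_norm c0) -sqrtr_sqr ler_wsqrtr //; lra.
by rewrite -/c; have := sqr_sqrtr s0; nra.
Qed.

Lemma beta_ge0 (m : R) : 0 <= m -> 0 <= beta lambda m.
Proof. by case/betaP. Qed.

(** The defining quadratic multiplied by [lambda], which clears the inverse and leaves nonnegative
    coefficients. *)
Lemma lambdaM_beta (m : R) : 0 <= m ->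
  lambda * m = lambda / 2 * beta lambda m ^+ 2 + (1 - lambda / 2) * beta lambda m.
Proof.
move=> /betaP[_ /eqP]; rewrite subr_eq0 => /eqP {1}<-.
by field; rewrite gt_eqF.
Qed.

(** By contraposition: the quadratic is nondecreasing on nonnegative reals. This serves both
    monotonicity and divergence of [beta]. *)
Lemma lt_beta (m b : R) : 0 <= m -> 0 <= b ->
  lambda / 2 * b ^+ 2 + (1 - lambda / 2) * b < lambda * m -> b < beta lambda m.
Proof.
move=> m0 b0; rewrite (lambdaM_beta m) //; apply: contraTT; rewrite -!leNgt => le_b.
have x0 := beta_ge0 m m0.
by rewrite lerD // ler_wpM2l ?ler_sqr ?nnegrE //; move: lambda_gt0 lambda_le1; lra.
Qed.

Lemma beta_homo (m1 m2 : R) : 0 <= m1 -> m1 < m2 ->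
  beta lambda m1 < beta lambda m2.
Proof.
move=> m10 lt_m; apply: lt_beta; [exact: le_trans (ltW lt_m)|exact: beta_ge0|].
by rewrite -lambdaM_beta // ltr_pM2l.
Qed.

Lemma threshold_homo (m1 m2 : R) (a : nat) : (1 <= a)%N -> 0 <= m1 -> m1 < m2 ->
  threshold lambda m1 a <= threshold lambda m2 a.
Proof.
move=> a1 m10 lt_m; have lt_b := beta_homo m1 m2 m10 lt_m.
have x0 := beta_ge0 m1 m10; have Ex := lambdaM_beta m1 m10.
have {}a1 : 1 <= a%:R :> R by rewrite ler1n.
rewrite /threshold; case: eqP => _; first exact: ltW.
have coef0 : 0 <= 1 - lambda + a%:R * lambda.
  by have := ler_wpM2r (ltW lambda_gt0) a1; lra.
case: (ltP _ (beta lambda m1)) => [lt_ab1|le_b1a].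
  by rewrite (lt_trans lt_ab1 lt_b) lerD2r ler_wpM2l // ltW.
case: ltP => [lt_ab2|_]; last by rewrite ler_wpM2l ?ltW.
rewrite Ex; move: (beta lambda m1) (beta lambda m2) x0 le_b1a lt_ab2 => x y.
move=> x0 le_xa lt_ay.
(* Here [x <= a < y]: compare both sides with the common value of the two expressions at [a]. *)
apply: (@le_trans _ _ (lambda / 2 * a%:R ^+ 2 + (1 - lambda / 2) * a%:R)).
  by rewrite lerD // ler_wpM2l ?ler_sqr ?nnegrE //; move: lambda_gt0 lambda_le1; lra.
(* This product is exactly the excess of the linear branch at [y] over that common value. *)
have : 0 <= (1 - lambda + a%:R * lambda) * (y - a%:R).
  by rewrite mulr_ge0 // subr_ge0 ltW.
lra.
Qed.

Lemma threshold0 (a : nat) : threshold lambda 0 a = 0.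
Proof.
have b0 : beta lambda 0 = 0.
  apply/le_anti; rewrite beta_ge0 // andbT.
  have := lambdaM_beta 0 (lexx 0); have := beta_ge0 0 (lexx 0).
  have := lambda_gt0; have := lambda_le1; nra.
(* With [beta] zero, [a < beta] fails, and both remaining branches vanish. *)
by rewrite /threshold b0 ltNge ler0n /= mulr0; case: eqP.
Qed.

Lemma threshold_gt_near (a : nat) (x : R) : (1 <= a)%N ->
  \forall m \near +oo, x < threshold lambda m a.
Proof.
move=> a1; have {}a1 : 1 <= a%:R :> R by rewrite ler1n.
(* The first term forces the linear branch, the second exceeds [x], and the third absorbs the
   subtracted [lambda * ((a - 1) * a / 2)]. *)
pose B : R := a%:R + `|x| + (a%:R - 1) * a%:R.
have aa0 : 0 <= (a%:R - 1) * a%:R :> R by rewrite mulr_ge0 //; lra.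
have x0 := normr_ge0 x; have xx := ler_norm x.
have B0 : 0 <= B by rewrite /B; lra.
near=> m.
have m0 : 0 <= m by near: m; exact: nbhs_pinfty_ge.
have ltB : B < beta lambda m.
  apply: lt_beta => //; rewrite -ltr_pdivrMl //.
  by near: m; apply: nbhs_pinfty_gt; exact: num_real.
rewrite /threshold; case: eqP => _; first by apply: le_lt_trans ltB; rewrite /B; lra.
have lt_ab : a%:R < beta lambda m by apply: le_lt_trans ltB; rewrite /B; lra.
rewrite lt_ab.
have : 0 <= lambda * (a%:R - 1) * beta lambda m.
  by rewrite !mulr_ge0 ?beta_ge0 ?(ltW lambda_gt0) ?subr_ge0.
have := ler_wpM2r aa0 lambda_le1; move: ltB; rewrite /B; lra.
Unshelve. all: by end_near. Qed.

End Thresholds.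

Theorem theorem2 (R : realType) (lambda : R) (lambda_gt0 : 0 < lambda)
    (lambda_le1 : lambda <= 1) :
  indexable (pi_D lambda).
Proof.
split.
- move=> m1 m2 m10 _ lt_m; rewrite !idle_set_threshold => -[a d] /= [a1 lt_d].
  by split=> //; apply: lt_le_trans lt_d _; exact: threshold_homo.
- rewrite idle_set_threshold; apply/seteqP; split=> -[a d] //= [_].
  by rewrite threshold0 // ltNge ler0n.
- move=> [a d] /= a1; have := threshold_gt_near _ _ lambda_gt0 lambda_le1 a d%:R a1.
  by apply: filterS => m lt_d; rewrite idle_set_threshold.
Qed.
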